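(* Let $X_\Sigma$ be a projective toric variety. Then: (1) There are only finitely many type one walls and type two walls in $\mathrm{Amp}(X_\Sigma)_{\mathbf R}$. (2) Each type one wall is the intersection of $\mathrm{Amp}(X_\Sigma)_{\mathbf R}$ with a codimension one linear subspace of $\mathrm{Pic}(X_\Sigma)_{\mathbf R}$, and the condition that $D=\sum_\rho a_\rho D_\rho\in \mathrm{Amp}(X_\Sigma)_{\mathbf R}$ lies in a given type one wall is a linear equation in the $a_\rho$ with rational coefficients (a rational hyperplane); the condition that $D$ lies in a given type two wall is a homogeneous quadratic equation in the $a_\rho$ with rational coefficients (a homogeneous quadratic hypersurface). (3) If $D,D'$ are ample divisors on $X_\Sigma$ whose induced stratifications of $\mathbf C^{\Sigma(1)}$ undergo a type one variation, then the line segment $\overline{DD'}$ intersects some type one wall properly. (4) If $D,D'$ are ample divisors on $X_\Sigma$ whose induced stratifications undergo a type two variation and $\overline{DD'}$ intersects no type one wall properly, then $\overline{DD'}$ intersects some type two wall properly. Moreover, $\mathrm{Amp}(X_\Sigma)_{\mathbf R}$ is the union of the walls and the semi-chambers, the semi-chambers are pairwise disjoint and finite in number, each semi-chamber is a cone (stable under multiplication by positive reals), and any two ample divisors lying in the same semi-chamber induce equivalent stratifications of $\mathbf C^{\Sigma(1)}$.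
   Context: Let $N$ be a lattice, $\Sigma$ a complete fan in $N_{\mathbf R}$ with set of rays $\Sigma(1)$, $u_\rho\in N$ the primitive generator of $\rho$, and $D_\rho$ the torus-invariant prime divisor of $X_\Sigma$ corresponding to $\rho$. A subset $C\subset\Sigma(1)$ is a primitive collection if $C\not\subset\sigma(1)$ for every cone $\sigma\in\Sigma$, but every proper subset of $C$ is contained in $\sigma(1)$ for some $\sigma\in\Sigma$. Let $\mathbf C^{\Sigma(1)}=\mathrm{Spec}\,\mathbf C[x_\rho:\rho\in\Sigma(1)]$ and $Z(\Sigma)=\bigcup_C V(x_\rho:\rho\in C)$, the union over primitive collections. Let $G=\mathrm{Hom}_{\mathbf Z}(\mathrm{Cl}(X_\Sigma),\mathbf C^\times)\subset(\mathbf C^\times)^{\Sigma(1)}$ (dual to the surjection $\mathbf Z^{\Sigma(1)}\to \mathrm{Cl}(X_\Sigma)$), acting coordinatewise on $\mathbf C^{\Sigma(1)}$. Its one-parameter subgroups are $\Gamma(G)=\{b\in\mathbf Z^{\Sigma(1)}:\sum_\rho b_\rho u_\rho=0\}$, with $b(t)\cdot x=(t^{b_\rho}x_\rho)_\rho$. For $D=\sum_\rho a_\rho D_\rho$ the corresponding character $\chi_D$ satisfies $\langle\chi_D,b\rangle=\sum_\rho a_\rho b_\rho$; extend $\mathbf R$-linearly to $\mathrm{Pic}(X_\Sigma)_{\mathbf R}\times\Gamma(G)_{\mathbf R}$. Give $\Gamma(G)_{\mathbf R}\subset\mathbf R^{\Sigma(1)}$ the restriction of the standard inner product $(-,-)$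 and norm $\|\cdot\|$; for $D\in\mathrm{Pic}(X_\Sigma)_{\mathbf R}$ let $\chi_D^*\in\Gamma(G)_{\mathbf R}$ be the vector with $(\chi_D^*,v)=\langle\chi_D,v\rangle$ for all $v$. $\mathrm{Amp}(X_\Sigma)_{\mathbf R}\subset \mathrm{Pic}(X_\Sigma)_{\mathbf R}$ is the ample cone (real cone over ample Cartier divisors); its elements are $\mathbf R$-ample divisors. Let $\mathcal L$ be the set of $S\subset\Sigma(1)$ with $S\subset\Sigma(1)\setminus C$ for some primitive collection $C$. For $S\in\mathcal L$: $\sigma_S=\{v\in\Gamma(G)_{\mathbf R}:v_\rho\ge0\ \forall\rho\in S\}$, $W_S=\{v\in\Gamma(G)_{\mathbf R}:v_\rho=0\ \forall\rho\in S\}$, $\mathrm{Proj}_W$ the orthogonal projection onto $W$, and for $D\in\mathrm{Amp}(X_\Sigma)_{\mathbf R}$, $\Lambda^D_S=\{-\mathrm{Proj}_{W_Z}\chi_D^*: Z\subset S,\ -\mathrm{Proj}_{W_Z}\chi_D^*\in\sigma_S\}$. For $x\in\mathbf C^{\Sigma(1)}$ let $S_x=\{\rho:x_\rho\neq0\}$ (so $x\in Z(\Sigma)$ iff $S_x\in\mathcal L$), and let $\lambda^D_x$ be the unique vector of maximal norm in $\Lambda^D_{S_x}$ (it is unique, and it spans the ray in $\sigma_{S_x}$ where $v\mapsto\langle\chi_D,v\rangle/\|v\|$ is minimal). Stratification induced by $D\in\mathrm{Amp}(X_\Sigma)_{\mathbf R}$: the strata are $\mathbf C^{\Sigma(1)}\setminus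 Z(\Sigma)$ (lowest) and $S^{\chi_D}_\lambda=\{x\in Z(\Sigma):\lambda^D_x=\lambda\}$ for $\lambda\in\Lambda^D=\{\lambda^D_x:x\in Z(\Sigma)\}$, strictly partially ordered by $S^{\chi_D}_\lambda>S^{\chi_D}_{\lambda'}$ iff $\|\lambda\|>\|\lambda'\|$. Two stratifications $\{Y_a\}_{a\in\mathcal A},\{Y_b\}_{b\in\mathcal B}$ of a space are equivalent if there is a bijection $\Phi:\mathcal A\to\mathcal B$ with $Y_{\Phi(a)}=Y_a$ and $\Phi(a)>\Phi(a')\iff a>a'$; there is a type one variation if no bijection satisfies the first condition, and a type two variation if some bijection satisfies the first but none satisfies both. Walls: a nonempty proper subset $H\subsetneq\mathrm{Amp}(X_\Sigma)_{\mathbf R}$ is a type one wall if there are $Z,\{\rho\}\in\mathcal L$ with $W_{Z\cup\{\rho\}}$ of codimension one in $W_Z$ and $H=\{D:\mathrm{Proj}_{W_Z}\chi_D^*=\mathrm{Proj}_{W_{Z\cup\{\rho\}}}\chi_D^*\}$ (defining function $F(D)=\langle\chi_{D_\rho},\mathrm{Proj}_{W_Z}\chi_D^*\rangle$); it is a type two wall if there are $Z_1,Z_2\in\mathcal L$ with neither of $W_{Z_1},W_{Z_2}$ containing the other and $H=\{D:\|\mathrm{Proj}_{W_{Z_1}}\chi_D^*\|=\|\mathrm{Proj}_{W_{Z_2}}\chi_D^*\|\}$ (defining function $F(D)=\|\mathrm{Proj}_{W_{Z_1}}\chi_D^*\|^2-\|\mathrm{Proj}_{W_{Z_2}}\chi_D^*\|^2$).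 If $F_1,\dots,F_k$ are the defining functions of all walls, a semi-chamber is a nonempty open set of the form $\{D\in\mathrm{Amp}(X_\Sigma)_{\mathbf R}:\epsilon_iF_i(D)>0\ \forall i\}$ with $\epsilon_i\in\{\pm1\}$. A segment $\overline{DD'}$ intersects a wall $H$ properly if $H\cap\overline{DD'}$ is nonempty and not all of $\overline{DD'}$. *)

(* Defs.v *)
From mathcomp Require Import all_boot all_order all_algebra.
From mathcomp Require Import complex.
From mathcomp Require Import classical_sets cardinality reals.

Set Implicit Arguments.
Unset Strict Implicit.
Unset Printing Implicit Defensive.

Import Order.TTheory GRing.Theory Num.Theory.
Local Open Scope ring_scope.

Section ToricGIT.

Variable R : realType.
(* N = Z^n ; the rays of Sigma are indexed by 'I_r ; row i of U is the
   primitive generator u_i of the i-th ray ; a cone of Sigma is recorded by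
   its set of rays sigma(1) ⊂ 'I_r. *)
Variables (n r : nat) (U : 'M[int]_(r, n)) (Sigma : {set {set 'I_r}}).

Definition UR : 'M[R]_(r, n) := map_mx (fun z : int => z%:~R) U.

Definition pairing (m : 'rV[R]_n) (i : 'I_r) : R := \sum_(j < n) m 0 j * UR i j.

Definition cone_of (S : {set 'I_r}) : set 'rV[R]_n :=
  fun v => exists c : 'I_r -> R,
    [/\ forall i, 0 <= c i, forall i, i \notin S -> c i = 0 &
        v = \sum_(i < r) c i *: row i UR].

(* cone(T) is the face cone(S) ∩ m^perp for some m in the dual cone of cone(S) *)
Definition face (T S : {set 'I_r}) : Prop :=
  T \subset S /\ exists m : 'rV[R]_n,
    (forall i, i \in S -> 0 <= pairing m i) /\
    (forall i, i \in S -> (i \in T) = (pairing m i == 0)).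

Definition strongly_convex (S : {set 'I_r}) : Prop :=
  forall v, cone_of S v -> cone_of S (- v) -> v = 0.

Definition primitive_row (i : 'I_r) : Prop :=
  forall (k : int) (v : 'rV[int]_n), row i U = k *: v -> k = 1 \/ k = -1.

Definition complete_fan : Prop :=
  [/\ (forall i, primitive_row i /\ [set i] \in Sigma),
      (forall S, S \in Sigma -> strongly_convex S),
      (forall S T, S \in Sigma -> face T S -> T \in Sigma),
      (forall S1 S2, S1 \in Sigma -> S2 \in Sigma ->
        [/\ face (S1 :&: S2) S1, face (S1 :&: S2) S2 &
            forall v, (cone_of S1 v /\ cone_of S2 v) <-> cone_of (S1 :&: S2) v]) &
      (forall v : 'rV[R]_n, exists2 S, S \in Sigma & cone_of S v)].

Definition maximal_cone (S : {set 'I_r}) : Prop :=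
  S \in Sigma /\ forall S', S' \in Sigma -> S \subset S' -> S' = S.

(* Divisors D = sum_i a_i D_i are row vectors a. *)
Definition R_Cartier (a : 'rV[R]_r) : Prop :=
  forall S, maximal_cone S ->
    exists m : 'rV[R]_n, forall i, i \in S -> pairing m i = - a 0 i.

(* D is in Amp(X_Sigma)_R : strictly convex support function *)
Definition Rample (a : 'rV[R]_r) : Prop :=
  forall S, maximal_cone S -> exists m : 'rV[R]_n, forall i,
    (i \in S -> pairing m i = - a 0 i) /\ (i \notin S -> - a 0 i < pairing m i).

Definition divR (d : 'rV[int]_r) : 'rV[R]_r := map_mx (fun z : int => z%:~R) d.

Definition ample_divisor (d : 'rV[int]_r) : Prop :=
  (forall S, maximal_cone S -> exists m : 'rV[int]_n,
      forall i, i \in S -> \sum_(j < n) m 0 j * U i j = - d 0 i)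
  /\ Rample (divR d).

Definition projective : Prop := exists d, ample_divisor d.

Definition prim_coll (C : {set 'I_r}) : Prop :=
  (forall S, S \in Sigma -> ~~ (C \subset S)) /\
  (forall C' : {set 'I_r}, C' \proper C -> exists2 S, S \in Sigma & C' \subset S).

Definition inL (S : {set 'I_r}) : Prop := exists C, prim_coll C /\ S \subset ~: C.

Definition dotr (v w : 'rV[R]_r) : R := \sum_(i < r) v 0 i * w 0 i.
Definition norm2 (v : 'rV[R]_r) : R := dotr v v.

(* W_S = {v in Gamma(G)_R : v_i = 0 for i in S}, as a row space;
   Gamma(G)_R = W_set0 = {v : sum_i v_i u_i = 0}. *)
Definition Wmx (S : {set 'I_r}) : 'M[R]_r :=
  kermx (row_mx UR (diag_mx (\row_i (i \in S)%:R))).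
Definition Gamma : 'M[R]_r := Wmx (@finset.set0 'I_r).

Definition orthproj (W : 'M[R]_r) (x : 'rV[R]_r) : 'rV[R]_r :=
  x *m (row_base W)^T *m invmx (row_base W *m (row_base W)^T) *m row_base W.

(* chi_D^* : the vector of Gamma(G)_R with (chi_D^*, v) = <chi_D, v> = sum a_i v_i *)
Definition chi_star (a : 'rV[R]_r) : 'rV[R]_r := orthproj Gamma a.

Definition sigma_cone (S : {set 'I_r}) (v : 'rV[R]_r) : Prop :=
  (v <= Gamma)%MS /\ forall i, i \in S -> 0 <= v 0 i.

Definition inLambda (a : 'rV[R]_r) (S : {set 'I_r}) (l : 'rV[R]_r) : Prop :=
  exists Z : {set 'I_r},
    [/\ Z \subset S, l = - orthproj (Wmx Z) (chi_star a) & sigma_cone S l].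

Definition supp (x : 'I_r -> R[i]) : {set 'I_r} := [set i | x i != 0].

Definition inZSigma (x : 'I_r -> R[i]) : Prop :=
  exists C, prim_coll C /\ forall i, i \in C -> x i = 0.

Definition is_lambda (a : 'rV[R]_r) (x : 'I_r -> R[i]) (l : 'rV[R]_r) : Prop :=
  inLambda a (supp x) l /\
  forall mu, inLambda a (supp x) mu -> norm2 mu <= norm2 l.

(* strata of the stratification induced by D: index None is the lowest
   stratum C^{Sigma(1)} \ Z(Sigma), index Some l is S^{chi_D}_l, l in Lambda^D *)
Definition strat_index (a : 'rV[R]_r) (o : option 'rV[R]_r) : Prop :=
  match o with
  | None => True
  | Some l => exists x, inZSigma x /\ is_lambda a x l
  end.

Definition stratum (a : 'rV[R]_r) (o : option 'rV[R]_r) : set ('I_r -> R[i]) :=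
  match o with
  | None => fun x => ~ inZSigma x
  | Some l => fun x => inZSigma x /\ is_lambda a x l
  end.

Definition strat_gt (o1 o2 : option 'rV[R]_r) : Prop :=
  match o1, o2 with
  | Some l1, Some l2 => norm2 l2 < norm2 l1
  | Some _, None => True
  | None, _ => False
  end.

Definition strata_bij (a a' : 'rV[R]_r) (Phi : option 'rV[R]_r -> option 'rV[R]_r) :=
  [/\ forall o, strat_index a o -> strat_index a' (Phi o),
      forall o1 o2, strat_index a o1 -> strat_index a o2 -> Phi o1 = Phi o2 -> o1 = o2,
      forall o', strat_index a' o' -> exists2 o, strat_index a o & Phi o = o' &
      forall o, strat_index a o -> forall x, stratum a' (Phi o) x <-> stratum a o x].

Definition order_preserving (a : 'rV[R]_r) (Phi : option 'rV[R]_r -> option 'rV[R]_r) :=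
  forall o1 o2, strat_index a o1 -> strat_index a o2 ->
    (strat_gt (Phi o1) (Phi o2) <-> strat_gt o1 o2).

Definition equiv_strat (a a' : 'rV[R]_r) : Prop :=
  exists Phi, strata_bij a a' Phi /\ order_preserving a Phi.

Definition type_one_variation (a a' : 'rV[R]_r) : Prop :=
  ~ exists Phi, strata_bij a a' Phi.

Definition type_two_variation (a a' : 'rV[R]_r) : Prop :=
  (exists Phi, strata_bij a a' Phi) /\ ~ equiv_strat a a'.

(* walls (as subsets of the divisor space lying over Amp(X_Sigma)_R) *)
Definition wall_like (H : set 'rV[R]_r) : Prop :=
  [/\ (exists a, H a), (forall a, H a -> Rample a) & (exists a, Rample a /\ ~ H a)].

Definition cond1 (Z : {set 'I_r}) (rho : 'I_r) : Prop :=
  [/\ inL Z, inL [set rho] & (\rank (Wmx (rho |: Z))).+1 = \rank (Wmx Z)].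

Definition H1 (Z : {set 'I_r}) (rho : 'I_r) : set 'rV[R]_r :=
  fun a => Rample a /\
    orthproj (Wmx Z) (chi_star a) = orthproj (Wmx (rho |: Z)) (chi_star a).

Definition F1 (Z : {set 'I_r}) (rho : 'I_r) (a : 'rV[R]_r) : R :=
  (orthproj (Wmx Z) (chi_star a)) 0 rho.

Definition wall1 (H : set 'rV[R]_r) : Prop :=
  wall_like H /\ exists Z rho, cond1 Z rho /\ H = H1 Z rho.

Definition cond2 (Z1 Z2 : {set 'I_r}) : Prop :=
  [/\ inL Z1, inL Z2, ~~ (Wmx Z1 <= Wmx Z2)%MS & ~~ (Wmx Z2 <= Wmx Z1)%MS].

Definition H2 (Z1 Z2 : {set 'I_r}) : set 'rV[R]_r :=
  fun a => Rample a /\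
    norm2 (orthproj (Wmx Z1) (chi_star a)) = norm2 (orthproj (Wmx Z2) (chi_star a)).

Definition F2 (Z1 Z2 : {set 'I_r}) (a : 'rV[R]_r) : R :=
  norm2 (orthproj (Wmx Z1) (chi_star a)) - norm2 (orthproj (Wmx Z2) (chi_star a)).

Definition wall2 (H : set 'rV[R]_r) : Prop :=
  wall_like H /\ exists Z1 Z2, cond2 Z1 Z2 /\ H = H2 Z1 Z2.

Definition sgn (b : bool) : R := if b then 1 else -1.

Definition semichamber (C : set 'rV[R]_r) : Prop :=
  (exists a, C a) /\
  exists (e1 : {set 'I_r} -> 'I_r -> bool) (e2 : {set 'I_r} -> {set 'I_r} -> bool),
    C = fun a => [/\ Rample a,
      forall Z rho, cond1 Z rho -> wall1 (H1 Z rho) -> 0 < sgn (e1 Z rho) * F1 Z rho a &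
      forall Z1 Z2, cond2 Z1 Z2 -> wall2 (H2 Z1 Z2) -> 0 < sgn (e2 Z1 Z2) * F2 Z1 Z2 a].

Definition segment (a b : 'rV[R]_r) : set 'rV[R]_r :=
  fun x => exists t : R, 0 <= t <= 1 /\ x = (1 - t) *: a + t *: b.

Definition meets_properly (H : set 'rV[R]_r) (a b : 'rV[R]_r) : Prop :=
  (exists x, segment a b x /\ H x) /\ ~ (forall x, segment a b x -> H x).

End ToricGIT.

(* Main.v *)
Require Import Defs.
From mathcomp Require Import all_boot all_order all_algebra.
From mathcomp Require Import complex polyrcf.
From mathcomp Require Import boolp classical_sets cardinality reals.
From mathcomp Require Import ring lra.
Set Implicit Arguments.
Unset Strict Implicit.
Import Order.TTheory GRing.Theory Num.Theory.
Local Open Scope ring_scope.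

(** Write [pr Z a] for the orthogonal projection of [chi_a^*] onto [W_Z].  The
    vector of maximal norm in [Lambda_S] is the point of the cone [sigma_S]
    nearest to [- a].  Locally at [- pr Z a], where [Z] is its set of tight
    constraints, [sigma_S] looks like [sigma_Z]; hence whether [- pr Z a] is
    that nearest point depends only on the signs of the coordinates of the
    [pr Y a], [Y] a subset of [Z], that is, on the signs of the type one
    defining functions.  So divisors at which these functions have equal signs
    induce the same strata, and the signs of the type two functions then
    determine the order.  A defining function restricted to a segment is a
    polynomial in the parameter, so its sign can only change across a wall met
    properly.  Rationality holds because every [W_Z] is defined over [rat]. *)

(** * Inner product and squared norm of row vectors *)

Section InnerProduct.
Variables (R : realType) (r : nat).
Implicit Types u v w x : 'rV[R]_r.

Lemma rVDE v w i : (v + w) 0 i = v 0 i + w 0 i. Proof. exact: mxE. Qed.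

Lemma rVNE v i : (- v) 0 i = - v 0 i. Proof. exact: mxE. Qed.

Lemma rVZE k v i : (k *: v) 0 i = k * v 0 i. Proof. exact: mxE. Qed.

Definition rVE := (rVDE, rVNE, rVZE).

Lemma dotrE v w : dotr v w = (v *m w^T) 0 0.
Proof. by rewrite mxE; apply: eq_bigr => i _; rewrite mxE. Qed.

Lemma dotrC v w : dotr v w = dotr w v.
Proof. by apply: eq_bigr => i _; rewrite mulrC. Qed.

Lemma dotrDl u v w : dotr (u + v) w = dotr u w + dotr v w.
Proof. by rewrite !dotrE mulmxDl mxE. Qed.

Lemma dotrZl k v w : dotr (k *: v) w = k * dotr v w.
Proof. by rewrite !dotrE -scalemxAl mxE. Qed.

Lemma dotrNl v w : dotr (- v) w = - dotr v w.
Proof. by rewrite -scaleN1r dotrZl mulN1r. Qed.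

Lemma dotrDr u v w : dotr u (v + w) = dotr u v + dotr u w.
Proof. by rewrite dotrC dotrDl !(dotrC _ u). Qed.

Lemma dotrZr k v w : dotr v (k *: w) = k * dotr v w.
Proof. by rewrite dotrC dotrZl dotrC. Qed.

Lemma dotrNr v w : dotr v (- w) = - dotr v w.
Proof. by rewrite dotrC dotrNl dotrC. Qed.

Definition dotr_lin := (dotrDl, dotrDr, dotrZl, dotrZr, dotrNl, dotrNr).

Lemma norm2_ge0 v : 0 <= norm2 v.
Proof. by apply: sumr_ge0 => i _; rewrite -expr2 sqr_ge0. Qed.

Lemma norm2_eq0 v : (norm2 v == 0) = (v == 0).
Proof.
apply/eqP/eqP => [|->]; last by rewrite /norm2 dotrE mul0mx mxE.
move=> /psumr_eq0P h; apply/rowP => i; rewrite mxE; apply/eqP.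
by rewrite -sqrf_eq0 expr2 h // => j _; rewrite -expr2 sqr_ge0.
Qed.

Lemma norm2D u v : norm2 (u + v) = norm2 u + 2 * dotr u v + norm2 v.
Proof. rewrite /norm2 !dotr_lin (dotrC v u); ring. Qed.

Lemma norm2Z k v : norm2 (k *: v) = k ^+ 2 * norm2 v.
Proof. by rewrite /norm2 !dotr_lin mulrA. Qed.

Lemma norm2N v : norm2 (- v) = norm2 v.
Proof. by rewrite /norm2 !dotr_lin opprK. Qed.

Lemma norm2_comb k l v w : norm2 (k *: v + l *: w) =
  k ^+ 2 * norm2 v + 2 * (k * l) * dotr v w + l ^+ 2 * norm2 w.
Proof. by rewrite norm2D !norm2Z !dotr_lin; ring. Qed.

End InnerProduct.

(** * Orthogonal projection onto the span of independent rows, as a matrix *)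

Definition projector (F : fieldType) (k r : nat) (B : 'M[F]_(k, r)) : 'M[F]_r :=
  B^T *m invmx (B *m B^T) *m B.

Lemma projector_sym (F : fieldType) (k r : nat) (B : 'M[F]_(k, r)) :
  (projector B)^T = projector B.
Proof. by rewrite /projector !trmx_mul trmx_inv !trmx_mul !trmxK mulmxA. Qed.

(** Lets a projector be computed over [rat] and then transported to [R]. *)
Lemma map_projector (F G : fieldType) (f : {rmorphism F -> G}) (k r : nat)
    (B : 'M[F]_(k, r)) : map_mx f (projector B) = projector (map_mx f B).
Proof. by rewrite /projector !map_mxM map_invmx map_mxM map_trmx. Qed.

Section OrthogonalProjector.
Variables (R : realType) (k r : nat).
Implicit Type B : 'M[R]_(k, r).

(** If [v] kills the Gram matrix, the squared norm of [v *m B] is 0, so positivity and independence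
    of the rows give [v = 0]. *)
Lemma gram_unit B : row_free B -> B *m B^T \in unitmx.
Proof.
move=> freeB; rewrite -row_free_unit; apply/row_freeP.
suff /eqP ker0 : kermx (B *m B^T) == 0.
  by apply/row_freeP; rewrite -kermx_eq0 ker0.
apply/eqP/row_matrixP => i; rewrite row0.
set v := row i _.
have v0 : v *m (B *m B^T) = 0 by apply/sub_kermxP/row_sub.
have : norm2 (v *m B) == 0.
  by rewrite /norm2 dotrE trmx_mul !mulmxA -(mulmxA v) v0 mul0mx mxE.
by rewrite norm2_eq0 mulmx_free_eq0 // => /eqP.
Qed.

Lemma projector_id B : row_free B -> B *m projector B = B.
Proof. by move=> freeB; rewrite /projector !mulmxA mulmxV ?gram_unit ?mul1mx. Qed.

Lemma projector_sub B (x : 'rV[R]_r) : (x *m projector B <= B)%MS.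
Proof. by rewrite /projector mulmxA submxMl. Qed.

Lemma projector_dot B (x w : 'rV[R]_r) : row_free B -> (w <= B)%MS ->
  dotr (x *m projector B) w = dotr x w.
Proof.
move=> freeB /submxP[D ->].
have symB : projector B *m B^T = B^T.
  by rewrite -{1}projector_sym -trmx_mul projector_id.
by rewrite !dotrE trmx_mul !(mulmxA _ B^T) -(mulmxA x (projector B)) symB.
Qed.

End OrthogonalProjector.

Lemma segment_submx (F : fieldType) (m k : nat) (V : 'M[F]_(m, k))
    (v w : 'rV_k) (t : F) :
  (v <= V)%MS -> (w <= V)%MS -> ((v + t *: (w - v))%R <= V)%MS.
Proof.
by move=> vV wV; rewrite addmx_sub // scalemx_sub // addmx_sub // eqmx_opp.
Qed.

(** * Projections onto the subspaces W_Z *)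

Section OrthProj.
Variables (R : realType) (n r : nat) (U : 'M[int]_(r, n)).
Implicit Types (Y Z S : {set 'I_r}) (a v w : 'rV[R]_r).

Notation W := (Wmx R U).
Notation Gam := (Gamma R U).

Lemma WmxP Z v :
  (v <= W Z)%MS <-> v *m UR R U = 0 /\ forall i, i \in Z -> v 0 i = 0.
Proof.
rewrite /Wmx; split.
  move/sub_kermxP; rewrite mul_mx_row -[0]row_mx0 => /eq_row_mx[-> vZ].
  split=> // i iZ; move/rowP/(_ i): vZ.
  by rewrite mul_mx_diag !mxE iZ mulr1.
move=> [vU vZ]; apply/sub_kermxP; rewrite mul_mx_row vU -[RHS]row_mx0.
congr row_mx; apply/rowP => i; rewrite mul_mx_diag !mxE.
by case: (boolP (i \in Z)) => [/vZ ->|_]; rewrite ?mul0r ?mulr0.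
Qed.

Lemma GammaP v : (v <= Gam)%MS <-> v *m UR R U = 0.
Proof. by split=> [/WmxP[]|vU] //; apply/WmxP; split=> // i; rewrite inE. Qed.

Lemma Wmx_sub_Gamma Z v : (v <= W Z)%MS -> (v <= Gam)%MS.
Proof. by case/WmxP => vU _; apply/GammaP. Qed.

Lemma WmxS Y Z v : Y \subset Z -> (v <= W Z)%MS -> (v <= W Y)%MS.
Proof.
move=> /fintype.subsetP sYZ /WmxP[vU vZ]; apply/WmxP; split=> // i iY.
exact/vZ/sYZ.
Qed.

Definition pr Z a : 'rV[R]_r := orthproj (W Z) (chi_star U a).

Lemma F1E Z i a : F1 U Z i a = pr Z a 0 i. Proof. by []. Qed.

Lemma F2E Y Z a : F2 U Y Z a = norm2 (pr Y a) - norm2 (pr Z a).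
Proof. by []. Qed.

Lemma orthproj_projector (V : 'M[R]_r) v :
  orthproj V v = v *m projector (row_base V).
Proof. by rewrite /orthproj /projector !mulmxA. Qed.

Lemma orthproj_sub (V : 'M[R]_r) v : (orthproj V v <= V)%MS.
Proof. by rewrite orthproj_projector -(eq_row_base V) projector_sub. Qed.

Lemma orthproj_dot (V : 'M[R]_r) v w :
  (w <= V)%MS -> dotr (orthproj V v) w = dotr v w.
Proof.
by rewrite orthproj_projector -(eq_row_base V); apply/projector_dot/row_base_free.
Qed.

Lemma pr_sub Z a : (pr Z a <= W Z)%MS.
Proof. exact: orthproj_sub. Qed.

(** Since W_Z lies in [Gamma], projecting first to [Gamma] and then to W_Z is the same as projecting
    [a] directly. *)
Lemma pr_dot Z a w : (w <= W Z)%MS -> dotr (pr Z a) w = dotr a w.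
Proof.
by move=> wZ; rewrite /pr orthproj_dot // orthproj_dot // (Wmx_sub_Gamma wZ).
Qed.

(** The difference of two candidates lies in W_Z and is orthogonal to itself. *)
Lemma pr_unique Z a v : (v <= W Z)%MS ->
  (forall w, (w <= W Z)%MS -> dotr v w = dotr a w) -> v = pr Z a.
Proof.
move=> vZ vdot; apply/eqP; rewrite -subr_eq0 -norm2_eq0.
have dZ : (v - pr Z a <= W Z)%MS by rewrite addmx_sub ?eqmx_opp ?pr_sub.
by rewrite /norm2 dotrDl dotrNl vdot ?pr_dot ?subrr.
Qed.

Lemma prD Z a b : pr Z (a + b) = pr Z a + pr Z b.
Proof. by rewrite /pr /chi_star /orthproj !mulmxDl. Qed.

Lemma prZ Z k a : pr Z (k *: a) = k *: pr Z a.
Proof. by rewrite /pr /chi_star /orthproj -!scalemxAl. Qed.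

Lemma pr_zero Z a i : i \in Z -> pr Z a 0 i = 0.
Proof. by move=> iZ; have /WmxP[_ ->] := pr_sub Z a. Qed.

Lemma pr_eqP Y Z a : Y \subset Z ->
  pr Y a = pr Z a <-> forall i, i \in Z -> pr Y a 0 i = 0.
Proof.
move=> sYZ; split=> [-> i|Z0]; first exact: pr_zero.
apply: pr_unique => [|w wZ]; last exact/pr_dot/WmxS/wZ.
by apply/WmxP; split=> //; have /WmxP[] := pr_sub Y a.
Qed.

(* The common value lies in W_(Y :|: Z), so it can be tested coordinatewise. *)
Lemma pr_eq_setP Y Z a : pr Y a = pr Z a <->
  (forall i, i \in Z -> pr Y a 0 i = 0) /\ (forall i, i \in Y -> pr Z a 0 i = 0).
Proof.
split=> [eYZ|[Y0 Z0]].
  by split=> i iX; [rewrite eYZ|rewrite -eYZ]; exact: pr_zero.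
transitivity (pr (Y :|: Z) a); last symmetry; apply/pr_eqP.
- exact: finset.subsetUl.
- by move=> i /setUP[/pr_zero|/Y0].
- exact: finset.subsetUr.
- by move=> i /setUP[/Z0|/pr_zero].
Qed.

(* Pythagoras in the triangle with vertices v, - pr Z a and - a. *)
Lemma dist_pr Z a v : (v <= W Z)%MS ->
  norm2 (v + a) = norm2 (v + pr Z a) + norm2 (a - pr Z a).
Proof.
move=> vZ; have -> : v + a = v + pr Z a + (a - pr Z a).
  by rewrite addrACA subrr addr0.
rewrite norm2D [dotr _ _](_ : _ = 0); first ring.
have uZ : ((v + pr Z a)%R <= W Z)%MS by rewrite addmx_sub ?pr_sub.
by rewrite dotrC dotrDl dotrNl pr_dot // subrr.
Qed.

Lemma norm2_pr Z a : norm2 (a - pr Z a) = norm2 a - norm2 (pr Z a).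
Proof.
rewrite norm2D norm2N dotrNr -(pr_dot a (pr_sub Z a)) -/(norm2 _); ring.
Qed.

(** Pythagoras for nested subspaces: the squared norms differ by that of [pr Y a - pr Z a]. *)
Lemma norm2_pr_sub Y Z a : (W Z <= W Y)%MS ->
  norm2 (pr Z a) <= norm2 (pr Y a) ?= iff (pr Y a == pr Z a).
Proof.
move=> sZY.
have zY : (- pr Z a <= W Y)%MS.
  by rewrite eqmx_opp (submx_trans (pr_sub Z a)).
have : norm2 (pr Y a) = norm2 (pr Z a) + norm2 (pr Y a - pr Z a).
  move: (dist_pr a zY); rewrite addrC norm2_pr [- _ + pr Y a]addrC norm2_pr.
  lra.
move=> ->; split; first by rewrite lerDl norm2_ge0.
by rewrite -subr_eq0 opprD addNKr oppr_eq0 norm2_eq0 subr_eq0.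
Qed.

(** W of [i |: Z] is the kernel of the [i]-th coordinate on W_Z, and [pr Z a] shows that this
    functional is non-zero. Hence the codimension condition on a type one wall holds as soon as its
    defining function is non-zero somewhere. *)
Lemma Wmx_rank1 Z i a : pr Z a 0 i != 0 ->
  (\rank (W (i |: Z))).+1 = \rank (W Z).
Proof.
move=> nz; pose e : 'cV[R]_r := delta_mx i 0.
have rowe v : v *m e = (v 0 i)%:M.
  apply/matrixP => j k; rewrite !ord1 !mxE mulr1n (bigD1 i) //= big1.
    by rewrite mxE !eqxx mulr1 addr0.
  by move=> j' /negPf ne; rewrite mxE ne mulr0.
have -> : \rank (W (i |: Z)) = \rank (W Z :&: kermx e)%MS.
  apply/eqmx_rank/andP; split; apply/row_subP => k; last first.
    have := row_sub k (W Z :&: kermx e)%MS.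
    rewrite sub_capmx => /andP[/WmxP[vU vZ] /sub_kermxP].
    rewrite rowe => v0; apply/WmxP; split=> // j /setU1P[->|/vZ //].
    by move/matrixP/(_ 0 0): v0; rewrite !mxE mulr1n.
  have /WmxP[vU vZ] := row_sub k (W (i |: Z)).
  rewrite sub_capmx; apply/andP; split.
    by apply/WmxP; split=> // j jZ; apply: vZ; rewrite inE jZ orbT.
  by apply/sub_kermxP; rewrite rowe vZ ?setU11 // raddf0.
rewrite -(mxrank_mul_ker (W Z) e) -addn1 addnC; congr (_ + _)%N.
apply/esym/eqP; rewrite eqn_leq rank_leq_col lt0n mxrank_eq0.
apply: contra nz => /eqP We0; have /submxP[D prE] := pr_sub Z a.
have := rowe (pr Z a); rewrite {1}prE -mulmxA We0 mulmx0.
by move/matrixP/(_ 0 0); rewrite !mxE mulr1n => <-.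
Qed.

End OrthProj.

(** * The vector of maximal norm as a nearest point of the cone *)

Section Kempf.
Variables (R : realType) (n r : nat) (U : 'M[int]_(r, n)).
Implicit Types (Y Z S : {set 'I_r}) (a v w l : 'rV[R]_r).

Notation W := (Wmx R U).
Notation pr := (pr U).

Lemma sigma_prN S Z a :
  sigma_cone U S (- pr Z a) <-> forall i, i \in S -> pr Z a 0 i <= 0.
Proof.
split=> [[_ ge0] i /ge0|le0]; first by rewrite rVE oppr_ge0.
split=> [|i /le0]; last by rewrite rVE oppr_ge0.
by rewrite eqmx_opp (Wmx_sub_Gamma (pr_sub U Z a)).
Qed.

(** Turns maximal norm within Lambda_S into minimal distance to [- a]. *)
Lemma inLambda_dist a S l : inLambda U a S l ->
  norm2 (l + a) = norm2 a - norm2 l.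
Proof. by case=> Z [_ -> _]; rewrite addrC norm2_pr norm2N. Qed.

(* Walk from v towards the point of W_Z nearest to - a, where Z is the set of
   constraints of the cone that are tight at v, until another one is tight. *)
Lemma inLambda_nearer a S v : sigma_cone U S v ->
  exists2 l, inLambda U a S l & norm2 (l + a) <= norm2 (v + a).
Proof.
(* Induction on the number of constraints in [S] that are not tight at [v]. *)
have [k] := ubnP #|[set i in S | v 0 i != 0]|.
elim: k v => // k IHk v /ltnSE card_k [vG v_ge0].
pose Z := [set i in S | v 0 i == 0]; pose m := - pr Z a.
have vZ : (v <= W Z)%MS.
  by apply/WmxP; split=> [|i]; [exact/GammaP|rewrite inE => /andP[_ /eqP]].
have mZ : (m <= W Z)%MS by rewrite eqmx_opp pr_sub.
have sZS : Z \subset S by apply/fintype.subsetP => i; rewrite inE => /andP[].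
have dist_m : norm2 (v + a) = norm2 (v - m) + norm2 (m + a).
  by rewrite (dist_pr a vZ) /m opprK (addrC (- _)).
have [mS|/existsNP[i /not_implyP[iS /negP]]] :=
  pselect (forall i, i \in S -> 0 <= m 0 i).
  exists m; last by rewrite dist_m lerDr norm2_ge0.
  by exists Z; split=> //; split=> //; exact: Wmx_sub_Gamma mZ.
rewrite -ltNge => mi_lt0.
have v_gt0 j : j \in S -> m 0 j < 0 -> 0 < v 0 j.
  move=> jS mj; rewrite lt_neqAle v_ge0 // andbT eq_sym; apply/negP => vj0.
  by move: mj; have /WmxP[_ ->] := mZ; rewrite ?ltxx // inE jS.
(* [q j] is the time at which coordinate [j] vanishes on the way from [v] to [m]; the least such
   time is the exit time from the cone. *)
pose q j := v 0 j / (v 0 j - m 0 j).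
have Pi : (i \in S) && (m 0 i < 0) by rewrite iS.
have [j /andP[jS mj] jmin] :=
  arg_minP q (P := fun j => (j \in S) && (m 0 j < 0)) Pi.
pose t := q j; have vj := v_gt0 j jS mj.
have t_gt0 : 0 < t by rewrite divr_gt0 // subr_gt0 (lt_trans mj).
have t_lt1 : t < 1.
  by rewrite ltr_pdivrMr ?mul1r ?subr_gt0 ?(lt_trans mj) // ltrDl oppr_gt0.
pose v' := v + t *: (m - v).
have v'E h : v' 0 h = (1 - t) * v 0 h + t * m 0 h by rewrite !rVE; ring.
have v'S : sigma_cone U S v'.
  split=> [|h hS].
    exact: segment_submx vG (Wmx_sub_Gamma mZ).
  rewrite v'E; have [mh|mh] := leP 0 (m 0 h).
    by apply: addr_ge0; rewrite mulr_ge0 ?v_ge0 // ?subr_ge0 ltW.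
  have := jmin h; rewrite hS mh => /(_ isT).
  rewrite -/t /q ler_pdivlMr; first by lra.
  by rewrite subr_gt0 (lt_trans mh) ?v_gt0.
have v'j : v' 0 j = 0.
  by rewrite v'E /t /q; field; rewrite subr_eq0 gt_eqF // (lt_trans mj).
have [|l lS ldist] := IHk v' _ v'S.
  rewrite (leq_trans _ card_k) //; apply/proper_card/properP; split.
    apply/fintype.subsetP => h; rewrite !inE => /andP[hS].
    rewrite hS /= v'E; apply: contraNneq => vh0.
    have hZ : h \in Z by rewrite inE hS vh0 eqxx.
    by have /WmxP[_ /(_ _ hZ) ->] := mZ; rewrite vh0 !mulr0 addr0.
  by exists j; rewrite !inE jS ?v'j ?eqxx ?gt_eqF.
exists l => //; apply: le_trans ldist _.
have v'Z : (v' <= W Z)%MS by exact: segment_submx.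
rewrite (dist_pr a v'Z) dist_m -/m [m + a]addrC /m opprK lerD2r.
have -> : v' + pr Z a = (1 - t) *: (v + pr Z a).
  by apply/rowP => h; rewrite !rVE; ring.
by rewrite norm2Z ler_piMl ?norm2_ge0 //; nra.
Qed.

(** [is_lambda] with an arbitrary set in place of the support of a point. *)
Definition lmax a S l :=
  inLambda U a S l /\ forall mu, inLambda U a S mu -> norm2 mu <= norm2 l.

(** Lambda_S is finite, and it is non-empty because [pr S a] vanishes on [S]. *)
Lemma lmax_exists a S : exists l, lmax a S l.
Proof.
pose P Z := `[< Z \subset S /\ sigma_cone U S (- pr Z a) >].
have PS : P S.
  apply/asboolP; split=> //.
  by apply/sigma_prN => i iS; rewrite (pr_zero U a iS).
have [Z /asboolP[sZS ZS] Zmax] := arg_maxP (fun Z => norm2 (pr Z a)) PS.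
exists (- pr Z a); split=> [|mu [Y [sYS -> YS]]]; first by exists Z.
by rewrite !norm2N; apply: Zmax; apply/asboolP.
Qed.

Lemma lmax_nearest a S l : lmax a S l ->
  forall v, sigma_cone U S v -> norm2 (l + a) <= norm2 (v + a).
Proof.
move=> [lS lge] v /(inLambda_nearer a)[mu muS]; apply: le_trans.
by rewrite !(@inLambda_dist _ S) // lerD2l lerN2 lge.
Qed.

Lemma nearest_lmax a S l : inLambda U a S l ->
  (forall v, sigma_cone U S v -> norm2 (l + a) <= norm2 (v + a)) -> lmax a S l.
Proof.
move=> lS lnear; split=> // mu muS; have [_ [_ _ /lnear]] := muS.
by rewrite !(@inLambda_dist _ S) // lerD2l lerN2.
Qed.

(* Sign conditions on the pr Y a that characterise the Z for which - pr Z a is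
   maximal: near - pr Z a the cone sigma_S agrees with sigma_Z, so maximality
   only has to be tested in sigma_Z, whose lineality space contains W_Z. *)
Definition tight a S Z :=
  [/\ Z \subset S, forall i, i \in S :\: Z -> pr Z a 0 i < 0 &
      forall Y, Y \subset Z -> (forall i, i \in Z -> pr Y a 0 i <= 0) ->
        forall i, i \in Z -> pr Y a 0 i = 0].

(** A maximal vector for [Z] is some [- pr Y a] with [Y] inside [Z], and the last clause of [tight]
    identifies it with [- pr Z a]. So this point is nearest in sigma_Z, and a fortiori in the
    smaller cone sigma_S. *)
Lemma tight_lmax a S Z : tight a S Z -> lmax a S (- pr Z a).
Proof.
move=> [sZS lt0 Yeq].
have leS i : i \in S -> pr Z a 0 i <= 0.
  move=> iS; have [iZ|iZ] := boolP (i \in Z); first by rewrite (pr_zero U a iZ).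
  by rewrite ltW // lt0 // inE iZ.
apply: nearest_lmax; first by exists Z; split=> //; apply/sigma_prN.
move=> v [vG v_ge0]; have [l lm] := lmax_exists a Z.
have vZ : sigma_cone U Z v.
  by split=> // i iZ; apply/v_ge0/(fintype.subsetP sZS).
have := lmax_nearest lm vZ; have [[Y [sYZ lE lZ]] _] := lm.
have /sigma_prN le0 : sigma_cone U Z (- pr Y a) by rewrite -[- _]lE.
have <- : pr Y a = pr Z a by apply/pr_eqP => //; exact: Yeq.
by rewrite -[- pr Y a]lE.
Qed.

(** Take for [Z] all constraints tight at [l]. If some [- pr X a] in sigma_Z, with [X] inside [Z],
    differed from [l], a short step from [l] towards it would stay in sigma_S and come strictly
    nearer to [- a]. *)
Lemma lmax_tight a S l : lmax a S l -> exists2 Z, tight a S Z & l = - pr Z a.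
Proof.
move=> lm; have [[Y [sYS lE lS]] _] := lm; rewrite -/(pr Y a) in lE.
pose Z := [set i in S | l 0 i == 0].
have sYZ : Y \subset Z.
  apply/fintype.subsetP => i iY; rewrite inE (fintype.subsetP sYS) //=.
  by rewrite lE rVE (pr_zero U a iY) oppr0.
have prYZ : pr Y a = pr Z a.
  apply/pr_eqP => // i; rewrite inE => /andP[_ /eqP/eqP].
  by rewrite lE rVE oppr_eq0 => /eqP.
have lZ : l = - pr Z a by rewrite -prYZ.
exists Z => //; split; first by apply/fintype.subsetP => i; rewrite inE => /andP[].
  move=> i; rewrite !inE => /andP[+ iS]; rewrite iS /= => nz.
  rewrite -oppr_gt0 -[- _]/((-%R : R -> R) _).
  by have := lS.2 i iS; rewrite le_eqVlt eq_sym (negPf nz) lZ rVE.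
move=> X sXZ le0; apply/pr_eqP => //.
set m := - pr X a.
have mX : (m <= W X)%MS by rewrite eqmx_opp pr_sub.
have lX : (l <= W X)%MS.
  by rewrite lZ eqmx_opp (WmxS sXZ) ?pr_sub.
apply/eqP/negPn/negP => neq.
have d_gt0 : 0 < norm2 (l - m).
  rewrite lt_neqAle norm2_ge0 andbT eq_sym norm2_eq0 subr_eq0 lZ.
  by rewrite (inj_eq (@oppr_inj _)) eq_sym.
have [e /andP[e_gt0 e_lt1] eS] : exists2 e : R, 0 < e < 1 &
    forall i, i \in S -> 0 <= (1 - e) * l 0 i + e * m 0 i.
  pose P i := (i \in S) && (l 0 i != 0).
  (* For [e <= q i] the loss [e * (l 0 i - m 0 i)] is at most [l 0 i]. The summand 1 keeps the
     denominator positive and [q i] below 1. *)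
  pose q i := l 0 i / (1 + l 0 i + `|m 0 i|).
  have den i : i \in S -> 0 < 1 + l 0 i + `|m 0 i|.
    move=> iS; have := lS.2 i iS; have := normr_ge0 (m 0 i); lra.
  have Z_ge0 i e : i \in S -> 0 <= e -> l 0 i = 0 ->
      0 <= (1 - e) * l 0 i + e * m 0 i.
    move=> iS e0 li; rewrite li mulr0 add0r mulr_ge0 // rVE oppr_ge0 le0 //.
    by rewrite inE iS li eqxx.
  have [P0|/existsNP[i0 /negP/negPn Pi0]] := pselect (forall i, ~~ P i); last first.
    have [j /andP[jS lj] jmin] := arg_minP q Pi0.
    have q_gt0 i : P i -> 0 < q i.
      case/andP=> iS li; rewrite divr_gt0 ?den //.
      by rewrite lt_neqAle eq_sym li lS.2.
    have q_lt1 : q j < 1.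
      rewrite ltr_pdivrMr ?den // mul1r.
      by have := normr_ge0 (m 0 j); lra.
    have qj0 : 0 < q j by rewrite q_gt0 // /P jS.
    exists (q j); first by rewrite qj0.
    move=> i iS; have [li|li] := eqVneq (l 0 i) 0; first exact: Z_ge0 (ltW qj0) li.
    have := jmin i; rewrite /P iS li => /(_ isT); rewrite {2}/q ler_pdivlMr ?den //.
    have := lS.2 i iS; have := ler_norm (- m 0 i); rewrite normrN.
    by move: qj0; nra.
  (* Every constraint in [S] is tight at [l], so any step length in the open unit interval works. *)
  exists 2^-1; first by apply/andP; split; lra.
  move=> i iS; apply: Z_ge0 => //; first by rewrite invr_ge0.
  by move: (P0 i); rewrite /P iS negbK => /eqP.
have vS : sigma_cone U S (l + e *: (m - l)).
  split=> [|i iS].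
    exact/Wmx_sub_Gamma/(segment_submx e lX mX).
  by rewrite (le_trans (eS i iS)) // !rVE; lra.
have := lmax_nearest lm vS.
have vX : ((l + e *: (m - l))%R <= W X)%MS.
  exact: segment_submx.
rewrite (dist_pr a vX) (dist_pr a lX) lerD2r.
have -> : l + e *: (m - l) + pr X a = (1 - e) *: (l + pr X a).
  by apply/rowP => h; rewrite !rVE; ring.
rewrite -[pr X a]opprK -/m norm2Z; apply/negP; rewrite -ltNge.
rewrite gtr_pMl // expr_lt1 //; lra.
Qed.

End Kempf.

(** * The strata and their order are determined by signs *)

Section SignEquivalence.
Variables (R : realType) (n r : nat) (U : 'M[int]_(r, n)).
Variable Sigma : {set {set 'I_r}}.
Implicit Types (Y Z S : {set 'I_r}) (a b v w l : 'rV[R]_r).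

Notation W := (Wmx R U).
Notation pr := (pr U).
Notation inL := (inL Sigma).

Lemma inLS Y Z : Y \subset Z -> inL Z -> inL Y.
Proof.
move=> sYZ [C [pC sZC]]; exists C; split=> //.
exact: fintype.subset_trans sZC.
Qed.

Lemma inL1 Z i : i \in Z -> inL Z -> inL [set i].
Proof. by move=> iZ; apply: inLS; rewrite finset.sub1set. Qed.

Lemma inZSigma_inL (x : 'I_r -> R[i]) : inZSigma Sigma x -> inL (supp x).
Proof.
move=> [C [pC x0]]; exists C; split=> //; apply/fintype.subsetP => i.
by rewrite !inE; apply: contra => /x0 ->.
Qed.

(** The codimension condition is left out: where it fails, [F1] is identically zero and its signs
    agree anyway. *)
Definition same_signs1 a b := forall Z i, inL Z -> inL [set i] ->
  Num.sg (F1 U Z i a) = Num.sg (F1 U Z i b).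

Definition same_signs2 a b := forall Y Z, cond2 R U Sigma Y Z ->
  Num.sg (F2 U Y Z a) = Num.sg (F2 U Y Z b).

Lemma same_signs1_sym a b : same_signs1 a b -> same_signs1 b a.
Proof. by move=> h Z i LZ Li; rewrite h. Qed.

Lemma same_signs1_0 a b Z i : same_signs1 a b -> inL Z -> inL [set i] ->
  pr Z a 0 i = 0 -> pr Z b 0 i = 0.
Proof.
move=> sab LZ Li a0; apply/eqP; rewrite -sgr_eq0 -[pr Z b 0 i]/(F1 U Z i b).
by rewrite -sab // sgr_eq0; exact/eqP.
Qed.

(** By [pr_eq_setP], coincidence of two projections is the vanishing of certain [F1], which signs
    detect. *)
Lemma same_signs1_eq a b Y Z : same_signs1 a b -> inL Y -> inL Z ->
  pr Y a = pr Z a -> pr Y b = pr Z b.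
Proof.
move=> sab LY LZ /pr_eq_setP[Y0 Z0]; apply/pr_eq_setP.
by split=> i iX; apply: (same_signs1_0 sab); auto; apply: (inL1 iX).
Qed.

(** Beyond the inclusion, [tight] consists of sign conditions on [F1], with index sets inside [S]
    and hence in L. *)
Lemma same_signs1_tight a b S Z :
  same_signs1 a b -> inL S -> tight U a S Z -> tight U b S Z.
Proof.
move=> sab LS [sZS lt0 Yeq]; have LZ := inLS sZS LS.
split=> // [i iS|Y sYZ le0 i iZ].
  rewrite -sgr_lt0 -[pr Z b 0 i]/(F1 U Z i b) -sab ?sgr_lt0 ?lt0 //.
  by move: iS; rewrite inE => /andP[_ iS]; apply: inL1 iS LS.
have LY := inLS sYZ LZ.
apply: (same_signs1_0 sab LY (inL1 iZ LZ) (Yeq Y sYZ _ i iZ)) => j jZ.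
rewrite -sgr_le0 -[pr Y a 0 j]/(F1 U Y j a) sab ?sgr_le0 ?le0 //.
exact: inL1 jZ LZ.
Qed.

Lemma lambda_tight a (x : 'I_r -> R[i]) l : inZSigma Sigma x -> is_lambda U a x l ->
  exists Z, [/\ inL Z, tight U a (supp x) Z & l = - pr Z a].
Proof.
move=> xZ /lmax_tight[Z tZ lE]; exists Z; split=> //.
by have [sZ _ _] := tZ; exact/inLS/inZSigma_inL/xZ.
Qed.

(** The tight set [Y] of the maximal vector need not be [Z], but the two projections agree at [a]
    and therefore at [b]. *)
Lemma is_lambda_transfer a b (x : 'I_r -> R[i]) Z : same_signs1 a b ->
  inL Z -> inZSigma Sigma x ->
  is_lambda U a x (- pr Z a) -> is_lambda U b x (- pr Z b).
Proof.
move=> sab LZ xZ /(lambda_tight xZ)[Y [LY tY /oppr_inj eZY]].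
rewrite (same_signs1_eq sab LZ LY eZY); apply/tight_lmax/same_signs1_tight/tY => //.
exact: inZSigma_inL.
Qed.

Lemma index_inL a l : strat_index U Sigma a (Some l) ->
  exists2 Z, inL Z & l = - pr Z a.
Proof. by move=> [x [xZ /(lambda_tight xZ)[Z [LZ _ ->]]]]; exists Z. Qed.

(** Writes an index as [- pr Z a] and replaces [a] by [b]. By [same_signs1_eq] the choice of [Z] is
    immaterial; the default [None] for vectors not of this form is never reached on actual
    indices. *)
Definition relabel a b (o : option 'rV[R]_r) : option 'rV[R]_r :=
  obind (fun l => omap (fun Z => - pr Z b)
    [pick Z | `[< inL Z /\ l = - pr Z a >]]) o.

Lemma relabelE a b Z : same_signs1 a b -> inL Z ->
  relabel a b (Some (- pr Z a)) = Some (- pr Z b).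
Proof.
move=> sab LZ; rewrite /relabel /=; case: pickP => [Y /asboolP[LY /oppr_inj eZY]|].
  by rewrite /= (same_signs1_eq sab LZ LY eZY).
by move/(_ Z)/asboolP; case.
Qed.

Lemma relabel_strata_bij a b : same_signs1 a b ->
  strata_bij U Sigma a b (relabel a b).
Proof.
move=> sab; have sba := same_signs1_sym sab.
(* Stated for any pair of divisors, since surjectivity uses it from [b] back to [a]. *)
have transfer c d Z : same_signs1 c d -> inL Z ->
    strat_index U Sigma c (Some (- pr Z c)) ->
    strat_index U Sigma d (Some (- pr Z d)).
  move=> scd LZ [x [xZ xl]]; exists x; split=> //.
  exact: is_lambda_transfer scd LZ xZ xl.
split.
- case=> // l ol; have [Z LZ lE] := index_inL ol; move: ol; rewrite lE relabelE //.
  exact: transfer.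
- move=> [l1|] [l2|] // o1 o2; first have [Z1 L1 ->] := index_inL o1.
  + have [Z2 L2 ->] := index_inL o2; rewrite !relabelE // => -[/oppr_inj e12].
    by rewrite (same_signs1_eq sba L1 L2 e12).
  + by have [Z1 L1 ->] := index_inL o1; rewrite relabelE.
  + by have [Z2 L2 ->] := index_inL o2; rewrite relabelE.
- case=> [l ol|_]; last by exists None.
  have [Z LZ lE] := index_inL ol; move: ol; rewrite lE => ol.
  by exists (Some (- pr Z a)); [exact: transfer ol|rewrite relabelE].
- case=> // l ol x; have [Z LZ ->] := index_inL ol; rewrite relabelE //.
  by split=> -[xZ xl]; split=> //; [move: sba LZ xZ xl|move: sab LZ xZ xl];
    exact: is_lambda_transfer.
Qed.

(** For nested subspaces strictness amounts to the two projections being distinct, which type one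
    signs decide; otherwise the pair satisfies [cond2] and a type two sign decides. *)
Lemma same_signs_norm_lt a b Y Z : same_signs1 a b -> same_signs2 a b ->
  inL Y -> inL Z ->
  norm2 (pr Y a) < norm2 (pr Z a) -> norm2 (pr Y b) < norm2 (pr Z b).
Proof.
move=> s1 s2 LY LZ ltYZ.
have [sYZ|nYZ] := boolP (W Y <= W Z)%MS.
  rewrite (lt_leif (norm2_pr_sub b sYZ)); apply: contraTN ltYZ => /eqP eb.
  rewrite -leNgt (same_signs1_eq (same_signs1_sym s1) LZ LY eb) //.
have [sZY|nZY] := boolP (W Z <= W Y)%MS.
  by move: ltYZ; rewrite ltNge (norm2_pr_sub a sZY).
have c : cond2 R U Sigma Y Z by split.
rewrite -subr_lt0 -sgr_lt0 -[_ - _]/(F2 U Y Z b) -s2 // sgr_lt0.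
by rewrite subr_lt0.
Qed.

Lemma same_signs2_sym a b : same_signs2 a b -> same_signs2 b a.
Proof. by move=> h Y Z c; rewrite h. Qed.

Lemma same_signs_equiv a b :
  same_signs1 a b -> same_signs2 a b -> equiv_strat U Sigma a b.
Proof.
move=> s1 s2; exists (relabel a b); split; first exact: relabel_strata_bij.
move=> [l1|] [l2|] o1 o2 //; first have [Z1 L1 ->] := index_inL o1.
- have [Z2 L2 ->] := index_inL o2; rewrite !relabelE // /strat_gt !norm2N.
  split; last exact: same_signs_norm_lt.
  apply: same_signs_norm_lt => //; first exact: same_signs1_sym.
  exact: same_signs2_sym.
- by have [Z1 L1 ->] := index_inL o1; rewrite relabelE.
Qed.

End SignEquivalence.

(** * Rationality of the defining functions *)

Section Rationality.
Variables (R : realType) (n r : nat) (U : 'M[int]_(r, n)).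
Implicit Types (Z : {set 'I_r}) (a : 'rV[R]_r).

Definition WmxQ Z : 'M[rat]_r :=
  kermx (row_mx (map_mx (fun z : int => z%:~R) U)
                (diag_mx (\row_i (i \in Z)%:R))).

Definition projQ Z : 'M[rat]_r := projector (row_base (WmxQ Z)).

Lemma map_WmxQ Z : map_mx ratr (WmxQ Z) = Wmx R U Z.
Proof.
have eU : map_mx ratr (map_mx (fun z : int => z%:~R) U) = UR R U.
  by apply/matrixP => i j; rewrite 3!mxE ratr_int.
have eZ : map_mx ratr (\row_(i < r) (i \in Z)%:R) =
    (\row_(i < r) (i \in Z)%:R : 'rV[R]_r).
  by apply/rowP => i; rewrite 3!mxE ratr_nat.
by rewrite /WmxQ map_kermx map_row_mx eU map_diag_mx eZ.
Qed.

(** A rational basis of W_Z remains a basis over [R]. It may differ from the one chosen by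
    [row_base] over [R], but [pr_unique] makes the projection independent of the basis. *)
Lemma pr_projQ Z a : pr U Z a = a *m map_mx ratr (projQ Z).
Proof.
rewrite /projQ; set B := row_base _.
rewrite map_projector.
have eBW : (map_mx ratr B == Wmx R U Z)%MS.
  by rewrite -map_WmxQ !map_submx; apply/eqmxP/eq_row_base.
have freeB : row_free (map_mx ratr B : 'M[R]_(_, _)).
  by rewrite row_free_map row_base_free.
symmetry; apply: pr_unique => [|w]; rewrite -(eqmxP eBW); first exact: projector_sub.
exact: projector_dot.
Qed.

(** Each row of [projQ Z], as a functional on divisors, kills principal divisors and so descends to
    Pic. *)
Lemma projQ_Gamma Z : projQ Z *m map_mx (fun z : int => z%:~R) U = 0.
Proof.
have /sub_kermxP : (projQ Z <= WmxQ Z)%MS.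
  by rewrite /projQ /projector (submx_trans (submxMl _ _)) ?eq_row_base.
by rewrite mul_mx_row -[0]row_mx0 => /eq_row_mx[].
Qed.

Lemma F1_rational Z i a :
  F1 U Z i a = \sum_(j < r) ratr (projQ Z i j) * a 0 j.
Proof.
have symP : (projQ Z)^T = projQ Z by rewrite /projQ projector_sym.
rewrite F1E pr_projQ mxE; apply: eq_bigr => j _.
by rewrite mxE -[in LHS]symP mxE mulrC.
Qed.

Lemma F2_rational Y Z a : F2 U Y Z a =
  (a *m map_mx ratr (projQ Y *m (projQ Y)^T - projQ Z *m (projQ Z)^T) *m a^T) 0 0.
Proof.
have quad (P : 'M[R]_r) : norm2 (a *m P) = (a *m (P *m P^T) *m a^T) 0 0.
  by rewrite /norm2 dotrE trmx_mul !mulmxA.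
have gram X : map_mx ratr (projQ X *m (projQ X)^T) =
    map_mx ratr (projQ X) *m (map_mx ratr (projQ X))^T :> 'M[R]_r.
  by rewrite map_mxM -map_trmx.
rewrite F2E (pr_projQ Y) (pr_projQ Z) 2!quad map_mxB 2!gram.
by rewrite mulmxBr mulmxBl [RHS]mxE [X in _ = _ + X]mxE.
Qed.

End Rationality.

(** * Signs of the defining functions along segments in the ample cone *)

Section Walls.
Variables (R : realType) (n r : nat) (U : 'M[int]_(r, n)).
Variable Sigma : {set {set 'I_r}}.
Implicit Types (Y Z S : {set 'I_r}) (a b : 'rV[R]_r).

Notation ample := (Rample U Sigma).

Lemma pairing_comb k l m1 m2 (i : 'I_r) :
  pairing (R:=R) U (k *: m1 + l *: m2) i = k * pairing U m1 i + l * pairing U m2 i.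
Proof.
rewrite /pairing !mulr_sumr -big_split; apply: eq_bigr => j _ /=.
by rewrite !rVE mulrDl !mulrA.
Qed.

(** The local linear data add up, and strictness survives because one weight is positive. These
    weights cover both segments and positive scaling. *)
Lemma Rample_comb k l a b : 0 <= k -> 0 <= l -> 0 < k + l ->
  ample a -> ample b -> ample (k *: a + l *: b).
Proof.
move=> k0 l0 kl aa ab S mS; have [m1 h1] := aa S mS; have [m2 h2] := ab S mS.
exists (k *: m1 + l *: m2) => i; rewrite pairing_comb !rVE.
have [e1 g1] := h1 i; have [e2 g2] := h2 i.
split=> iS; first by rewrite e1 // e2 // !mulrN opprD.
have x0 : 0 < pairing U m1 i + a 0 i by move: (g1 iS); lra.
have y0 : 0 < pairing U m2 i + b 0 i by move: (g2 iS); lra.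
suff : 0 < k * (pairing U m1 i + a 0 i) + l * (pairing U m2 i + b 0 i) by lra.
have [l_gt0|l_le0] := ltP 0 l.
  by rewrite ltr_wpDl ?mulr_gt0 // mulr_ge0 // ltW.
by rewrite ltr_wpDr ?mulr_gt0 ?mulr_ge0 // ?(ltW y0) //; lra.
Qed.

Lemma Rample_segment a b t : 0 <= t <= 1 -> ample a -> ample b ->
  ample ((1 - t) *: a + t *: b).
Proof. by case/andP=> t0 t1; apply: Rample_comb => //; lra. Qed.

Lemma Rample_scale k a : 0 < k -> ample a -> ample (k *: a).
Proof.
move=> k0 aa; rewrite -[k *: a]addr0 -(scale0r a); apply: Rample_comb => //; lra.
Qed.

(** Opposite signs at the ends would force a root by the intermediate value theorem. *)
Lemma sgr_horner (p : {poly R}) : (forall t, 0 <= t <= 1 -> p.[t] != 0) ->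
  Num.sg p.[0] = Num.sg p.[1].
Proof.
move=> nz; have p0 : p.[0] != 0 by rewrite nz ?lexx ?ler01.
have p1 : p.[1] != 0 by rewrite nz ?lexx ?ler01.
have [neg|] := ltP (p.[0] * p.[1]) 0.
  have [t] := poly_ivtoo (@ler01 R) neg.
  rewrite in_itv /= => /andP[t0 t1] /rootP pt0.
  by move: (nz t); rewrite pt0 eqxx !ltW // => /(_ isT).
rewrite le_eqVlt eq_sym mulf_eq0 (negPf p0) (negPf p1) /= => pos.
have [n0|n0|e0] := ltgtP p.[0] 0; last by rewrite e0 eqxx in p0.
  by rewrite (ltr0_sg n0) ltr0_sg // -(nmulr_rgt0 _ n0).
by rewrite (gtr0_sg n0) gtr0_sg // -(pmulr_rgt0 _ n0).
Qed.

Definition zero_locus (F : 'rV[R]_r -> R) : set 'rV[R]_r :=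
  fun a => ample a /\ F a = 0.

(** Without a zero on the segment the sign is constant, and if [F] vanishes on all of it both signs
    are 0. In the remaining case the zero locus is a non-empty proper subset of the ample cone and
    meets the segment properly. *)
Lemma same_sign_segment (F : 'rV[R]_r -> R) (p : {poly R}) a b :
  (forall t, F ((1 - t) *: a + t *: b) = p.[t]) -> ample a -> ample b ->
  ~ (wall_like U Sigma (zero_locus F) /\ meets_properly (zero_locus F) a b) ->
  Num.sg (F a) = Num.sg (F b).
Proof.
move=> Fp aa ab nowall.
have Fa : F a = p.[0] by rewrite -Fp subr0 scale1r scale0r addr0.
have Fb : F b = p.[1] by rewrite -Fp subrr scale0r scale1r add0r.
have [nz|/existsNP[t /not_implyP[t01 /negP/negPn/eqP pt0]]] :=
  pselect (forall t, 0 <= t <= 1 -> p.[t] != 0); first by rewrite Fa Fb sgr_horner.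
pose c := (1 - t) *: a + t *: b.
have cs : segment a b c by exists t.
have cH : zero_locus F c by split; [exact: Rample_segment|rewrite Fp].
have [all0|/existsNP[x /not_implyP[xs xH]]] :=
    pselect (forall x, segment a b x -> zero_locus F x).
  have [|_ ->] := all0 a.
    by exists 0; rewrite lexx ler01 subr0 scale1r scale0r addr0.
  have [|_ ->] := all0 b => //.
  by exists 1; rewrite lexx ler01 subrr scale0r scale1r add0r.
case: nowall; split; last first.
  by split; [exists c|move=> all0; apply/xH/all0].
split; [by exists c|by move=> x' []|exists x; split=> //].
by have [u [u01 ->]] := xs; exact: Rample_segment.
Qed.

Lemma H1E Z i : H1 (R:=R) U Sigma Z i = zero_locus (F1 U Z i).
Proof.
apply: funext => a; apply: propext; rewrite /H1 /zero_locus F1E.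
rewrite -/(pr U Z a) -/(pr U (i |: Z) a).
split=> -[aa h]; split=> //; first by rewrite h (pr_zero U a (setU11 i Z)).
apply/pr_eqP; first exact: finset.subsetUr.
by move=> j /setU1P[->//|]; exact: pr_zero.
Qed.

Lemma H2E Y Z : H2 (R:=R) U Sigma Y Z = zero_locus (F2 U Y Z).
Proof.
apply: funext => a; apply: propext; rewrite /H2 /zero_locus F2E.
rewrite -/(pr U Y a) -/(pr U Z a).
by split=> -[aa h]; split=> //; [rewrite h subrr|apply/eqP; rewrite -subr_eq0 h].
Qed.

Lemma F1_segment Z i a b t : F1 U Z i ((1 - t) *: a + t *: b) =
  ((F1 U Z i a)%:P * (1 - 'X) + (F1 U Z i b)%:P * 'X).[t].
Proof.
rewrite !hornerE !F1E prD !prZ !rVE; ring.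
Qed.

Lemma F1_scale Z i k a : F1 U Z i (k *: a) = k * F1 U Z i a.
Proof. by rewrite !F1E prZ rVE. Qed.

Lemma F2_scale Y Z k a : F2 U Y Z (k *: a) = k ^+ 2 * F2 U Y Z a.
Proof.
by rewrite !F2E !prZ !norm2Z mulrBr.
Qed.

Lemma F2_segment Y Z a b : exists p : {poly R},
  forall t, F2 U Y Z ((1 - t) *: a + t *: b) = p.[t].
Proof.
(* [c] is the polar form of the quadratic form [F2 U Y Z] at [a] and [b]. *)
pose c := dotr (pr U Y a) (pr U Y b) - dotr (pr U Z a) (pr U Z b).
exists ((F2 U Y Z a)%:P * (1 - 'X) * (1 - 'X) + (2 * c)%:P * (1 - 'X) * 'X +
        (F2 U Y Z b)%:P * 'X * 'X) => t.
rewrite !hornerE F2E (prD U Y) (prD U Z) !prZ 2!norm2_comb 2!F2E /c; ring.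
Qed.

Lemma F1_cond1 Z i a : inL Sigma Z -> inL Sigma [set i] -> F1 U Z i a != 0 ->
  cond1 R U Sigma Z i.
Proof. by move=> LZ Li nz; split=> //; exact: Wmx_rank1 nz. Qed.

Lemma same_sign1_segment Z i a b : inL Sigma Z -> inL Sigma [set i] ->
  ample a -> ample b -> (cond1 R U Sigma Z i ->
  ~ (wall1 U Sigma (H1 (R:=R) U Sigma Z i) /\
    meets_properly (H1 (R:=R) U Sigma Z i) a b)) ->
  Num.sg (F1 U Z i a) = Num.sg (F1 U Z i b).
Proof.
move=> LZ Li aa ab nowall.
have [c|nc] := pselect (cond1 R U Sigma Z i).
  apply: (same_sign_segment (F1_segment Z i a b) aa ab) => -[wl mp].
  apply: (nowall c); rewrite H1E; split=> //; split=> //.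
  by exists Z, i; rewrite H1E.
have F0 (x : 'rV[R]_r) : F1 U Z i x = 0.
  by apply/eqP/negPn/negP => nz; exact: nc (F1_cond1 LZ Li nz).
by rewrite !F0.
Qed.

Lemma same_sign2_segment Y Z a b : cond2 R U Sigma Y Z -> ample a -> ample b ->
  ~ (wall2 U Sigma (H2 (R:=R) U Sigma Y Z) /\
    meets_properly (H2 (R:=R) U Sigma Y Z) a b) ->
  Num.sg (F2 U Y Z a) = Num.sg (F2 U Y Z b).
Proof.
move=> c aa ab nowall; have [p pE] := F2_segment Y Z a b.
apply: (same_sign_segment pE aa ab) => -[wl mp].
by apply: nowall; rewrite H2E; split=> //; split=> //; exists Y, Z; rewrite H2E.
Qed.

Lemma sgn_sgr e (x y : R) :
  0 < sgn R e * x -> 0 < sgn R e * y -> Num.sg x = Num.sg y.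
Proof.
case: e; rewrite /sgn ?mul1r ?mulN1r ?oppr_gt0.
  by move=> /gtr0_sg-> /gtr0_sg->.
by move=> /ltr0_sg-> /ltr0_sg->.
Qed.

(** The chamber fixes the signs for actual walls. A defining function whose zero locus is no wall
    has equal signs at any two ample points, by the segment argument. *)
Lemma semichamber_equiv C a b : semichamber U Sigma C -> C a -> C b ->
  equiv_strat U Sigma a b.
Proof.
move=> [_ [e1 [e2 ->]]] [aa a1 a2] [ab b1 b2]; apply: same_signs_equiv.
  move=> Z i LZ Li.
  have [[c w]|ncw] :=
      pselect (cond1 R U Sigma Z i /\ wall1 U Sigma (H1 (R:=R) U Sigma Z i)).
    exact: sgn_sgr (a1 Z i c w) (b1 Z i c w).
  by apply: same_sign1_segment => // c -[w _]; apply: ncw.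
move=> Y Z c.
have [w|nw] := pselect (wall2 U Sigma (H2 (R:=R) U Sigma Y Z)); last first.
  by apply: same_sign2_segment => // -[].
exact: sgn_sgr (a2 Y Z c w) (b2 Y Z c w).
Qed.

End Walls.

(** * Walls and semi-chambers *)

Section Theorems.
Variables (R : realType) (n r : nat) (U : 'M[int]_(r, n)).
Variable Sigma : {set {set 'I_r}}.
Implicit Types (Y Z S : {set 'I_r}) (a b : 'rV[R]_r) (H C : set 'rV[R]_r).

Notation ample := (Rample U Sigma).

Lemma finite_walls :
  finite_set (wall1 (R:=R) U Sigma) /\ finite_set (wall2 (R:=R) U Sigma).
Proof.
split.
  apply: (@sub_finite_set _ _
    [set H1 (R:=R) U Sigma p.1 p.2 | p in [set: {set 'I_r} * 'I_r]]%classic).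
    by move=> H [_ [Z [i [_ ->]]]]; exists (Z, i).
  exact/finite_image/finite_finset.
apply: (@sub_finite_set _ _
  [set H2 (R:=R) U Sigma p.1 p.2 | p in [set: {set 'I_r} * {set 'I_r}]]%classic).
  by move=> H [_ [Y [Z [_ ->]]]]; exists (Y, Z).
exact/finite_image/finite_finset.
Qed.

Lemma Rample_Cartier a : ample a -> R_Cartier U Sigma a.
Proof. by move=> aa S /aa[m h]; exists m => i; case: (h i). Qed.

Lemma wall1_rational H : wall1 U Sigma H ->
  exists c : 'rV[rat]_r,
    [/\ c *m map_mx (fun z : int => z%:~R) U = 0,
        exists a : 'rV[R]_r, R_Cartier U Sigma a /\
                             \sum_(i < r) ratr (c 0 i) * a 0 i != 0 &
        H = fun a => Rample U Sigma a /\ \sum_(i < r) ratr (c 0 i) * a 0 i = 0].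
Proof.
move=> [[_ _ [b [ab bH]]] [Z [i [_ HE]]]].
exists (row i (projQ U Z)).
have sumE a : \sum_(j < r) ratr (row i (projQ U Z) 0 j) * a 0 j = F1 U Z i a.
  by rewrite F1_rational; apply: eq_bigr => j _; rewrite [row _ _ _ _]mxE.
have HE' : H = fun a =>
    ample a /\ \sum_(j < r) ratr (row i (projQ U Z) 0 j) * a 0 j = 0.
  by rewrite HE H1E; apply: funext => a; rewrite sumE.
split=> //; first by rewrite -row_mul projQ_Gamma row0.
(* [b] is an ample class off the wall, which exists because a wall is a proper subset. *)
exists b; split; first exact: Rample_Cartier.
by apply/eqP => b0; apply: bH; rewrite HE'.
Qed.

Lemma wall2_rational H : wall2 U Sigma H ->
  exists Q : 'M[rat]_r,
    (exists a : 'rV[R]_r, (a *m map_mx ratr Q *m a^T) 0 0 != 0) /\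
    H = fun a => Rample U Sigma a /\ (a *m map_mx ratr Q *m a^T) 0 0 = 0.
Proof.
move=> [[_ _ [b [ab bH]]] [Y [Z [_ HE]]]].
exists (projQ U Y *m (projQ U Y)^T - projQ U Z *m (projQ U Z)^T).
split; last by rewrite HE H2E; apply: funext => a; rewrite -F2_rational.
exists b; rewrite -F2_rational; apply/eqP => b0; apply: bH.
by rewrite HE H2E.
Qed.

Lemma no_wall1_same_signs a b : ample a -> ample b ->
  (forall H, wall1 U Sigma H -> ~ meets_properly H a b) ->
  same_signs1 U Sigma a b.
Proof.
move=> aa ab no Z i LZ Li; apply: (same_sign1_segment LZ Li aa ab) => _ -[].
exact: no.
Qed.

Lemma no_wall2_same_signs a b : ample a -> ample b ->
  (forall H, wall2 U Sigma H -> ~ meets_properly H a b) ->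
  same_signs2 U Sigma a b.
Proof.
move=> aa ab no Y Z c; apply: (same_sign2_segment c aa ab) => -[]; exact: no.
Qed.

Lemma sgn_gt0 (x : R) : x != 0 -> 0 < sgn R (0 < x) * x.
Proof.
rewrite /sgn => x0; have [x_gt0|x_le0] := boolP (0 < x); first by rewrite mul1r.
by rewrite mulN1r oppr_gt0 lt_neqAle x0 leNgt.
Qed.

Lemma walls_semichambers_cover a : ample a ->
  (exists H, (wall1 U Sigma H \/ wall2 U Sigma H) /\ H a) \/
  (exists C, semichamber U Sigma C /\ C a).
Proof.
move=> aa; apply: or_asboolP; apply/orP.
have [|nowall] := pselect (exists H, (wall1 U Sigma H \/ wall2 U Sigma H) /\ H a).
  by left; apply/asboolP.
right; apply/asboolP.
(* The chamber is cut out by the signs at [a] itself, which are non-zero on every wall function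
   because [a] is on no wall. *)
pose e1 Z i := 0 < F1 U Z i a; pose e2 Y Z := 0 < F2 U Y Z a.
pose C : set 'rV[R]_r := fun b => [/\ ample b,
  forall Z i, cond1 R U Sigma Z i -> wall1 U Sigma (H1 (R:=R) U Sigma Z i) ->
    0 < sgn R (e1 Z i) * F1 U Z i b &
  forall Y Z, cond2 R U Sigma Y Z -> wall2 U Sigma (H2 (R:=R) U Sigma Y Z) ->
    0 < sgn R (e2 Y Z) * F2 U Y Z b].
have Ca : C a.
  split=> // [Z i _ w|Y Z _ w]; apply: sgn_gt0; apply/eqP => F0; apply: nowall.
    by exists (H1 (R:=R) U Sigma Z i); split; [left|rewrite H1E].
  by exists (H2 (R:=R) U Sigma Y Z); split; [right|rewrite H2E].
by exists C; split=> //; split; [exists a|exists e1, e2].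
Qed.

Lemma sgn_eq e e' (x : R) : 0 < sgn R e * x -> 0 < sgn R e' * x -> e = e'.
Proof. by case: e e' => [] []; rewrite /sgn //; lra. Qed.

(** A common point forces the two sign patterns to agree at every wall, and only those entries
    define the chamber. *)
Lemma semichamber_disjoint C C' : semichamber U Sigma C -> semichamber U Sigma C' ->
  C <> C' -> forall a, C a -> ~ C' a.
Proof.
move=> [_ [e1 [e2 CE]]] [_ [e1' [e2' CE']]] neq a Ca Ca'; apply: neq.
move: Ca Ca'; rewrite CE CE' => -[_ a1 a2] [_ a1' a2'].
have E1 Z i : cond1 R U Sigma Z i -> wall1 U Sigma (H1 (R:=R) U Sigma Z i) ->
    e1 Z i = e1' Z i.
  by move=> c w; exact: sgn_eq (a1 _ _ c w) (a1' _ _ c w).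
have E2 Y Z : cond2 R U Sigma Y Z -> wall2 U Sigma (H2 (R:=R) U Sigma Y Z) ->
    e2 Y Z = e2' Y Z.
  by move=> c w; exact: sgn_eq (a2 _ _ c w) (a2' _ _ c w).
apply: funext => b; apply: propext.
split=> -[ab b1 b2]; split=> // X Y c w.
- by rewrite -E1 //; exact: b1.
- by rewrite -E2 //; exact: b2.
- by rewrite E1 //; exact: b1.
- by rewrite E2 //; exact: b2.
Qed.

Lemma finite_semichambers : finite_set (semichamber (R:=R) U Sigma).
Proof.
(* Sign patterns are recoded as finite functions so that they range over a finite type. *)
pose T := ({ffun {set 'I_r} * 'I_r -> bool} *
           {ffun {set 'I_r} * {set 'I_r} -> bool})%type.
pose chamber (e : T) : set 'rV[R]_r := fun a => [/\ ample a,
  forall Z i, cond1 R U Sigma Z i -> wall1 U Sigma (H1 (R:=R) U Sigma Z i) ->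
    0 < sgn R (e.1 (Z, i)) * F1 U Z i a &
  forall Y Z, cond2 R U Sigma Y Z -> wall2 U Sigma (H2 (R:=R) U Sigma Y Z) ->
    0 < sgn R (e.2 (Y, Z)) * F2 U Y Z a].
apply: (@sub_finite_set _ _ [set chamber e | e in [set: T]]%classic).
  move=> C [_ [e1 [e2 ->]]].
  exists ([ffun p => e1 p.1 p.2], [ffun p => e2 p.1 p.2]) => //.
  apply: funext => a; apply: propext; rewrite /chamber /=.
  split=> -[aa a1 a2]; split=> // X Y c w.
  - by have := a1 X Y c w; rewrite ffunE.
  - by have := a2 X Y c w; rewrite ffunE.
  - by rewrite ffunE; exact: a1.
  - by rewrite ffunE; exact: a2.
exact/finite_image/finite_finset.
Qed.

Lemma semichamber_scale C : semichamber U Sigma C ->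
  forall (t : R) a, 0 < t -> C a -> C (t *: a).
Proof.
move=> [_ [e1 [e2 ->]]] t a t0 [aa a1 a2]; split; first exact: Rample_scale.
  by move=> Z i c w; rewrite F1_scale mulrCA mulr_gt0 // a1.
by move=> Y Z c w; rewrite F2_scale mulrCA mulr_gt0 ?exprn_gt0 // a2.
Qed.

End Theorems.

Unset Implicit Arguments.

Theorem theoremA (R : realType) (n r : nat) (U : 'M[int]_(r, n))
    (Sigma : {set {set 'I_r}}) :
  complete_fan R U Sigma -> projective R U Sigma ->
  (* (1) finitely many walls *)
  [/\ finite_set (wall1 (R:=R) U Sigma) /\ finite_set (wall2 (R:=R) U Sigma),
  (* (2) type one walls: rational hyperplanes of Pic_R; type two walls:
     rational homogeneous quadrics *)
    (forall H : set 'rV[R]_r, wall1 U Sigma H ->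
       exists c : 'rV[rat]_r,
         [/\ c *m map_mx (fun z : int => z%:~R) U = 0,
             exists a : 'rV[R]_r, R_Cartier U Sigma a /\
                                  \sum_(i < r) ratr (c 0 i) * a 0 i != 0 &
             H = fun a => Rample U Sigma a /\ \sum_(i < r) ratr (c 0 i) * a 0 i = 0])
    /\
    (forall H : set 'rV[R]_r, wall2 U Sigma H ->
       exists Q : 'M[rat]_r,
         (exists a : 'rV[R]_r, (a *m map_mx ratr Q *m a^T) 0 0 != 0) /\
         H = fun a => Rample U Sigma a /\ (a *m map_mx ratr Q *m a^T) 0 0 = 0),
  (* (3) *)
    (forall d d' : 'rV[int]_r, ample_divisor R U Sigma d -> ample_divisor R U Sigma d' ->
       type_one_variation U Sigma (divR R d) (divR R d') ->
       exists2 H : set 'rV[R]_r, wall1 U Sigma H & meets_properly H (divR R d) (divR R d')),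
  (* (4) *)
    (forall d d' : 'rV[int]_r, ample_divisor R U Sigma d -> ample_divisor R U Sigma d' ->
       type_two_variation U Sigma (divR R d) (divR R d') ->
       (forall H : set 'rV[R]_r, wall1 U Sigma H -> ~ meets_properly H (divR R d) (divR R d')) ->
       exists2 H : set 'rV[R]_r, wall2 U Sigma H & meets_properly H (divR R d) (divR R d')) &
  (* moreover *)
    [/\ (forall a, Rample U Sigma a ->
           (exists H : set 'rV[R]_r, (wall1 U Sigma H \/ wall2 U Sigma H) /\ H a) \/
           (exists C : set 'rV[R]_r, semichamber U Sigma C /\ C a)),
        (forall C C' : set 'rV[R]_r, semichamber U Sigma C -> semichamber U Sigma C' -> C <> C' ->
           forall a, C a -> ~ C' a),
        finite_set (semichamber (R:=R) U Sigma),
        (forall C : set 'rV[R]_r, semichamber U Sigma C ->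
           forall (t : R) a, 0 < t -> C a -> C (t *: a)) &
        (forall C : set 'rV[R]_r, semichamber U Sigma C ->
           forall d d' : 'rV[int]_r, ample_divisor R U Sigma d -> ample_divisor R U Sigma d' ->
           C (divR R d) -> C (divR R d') -> equiv_strat U Sigma (divR R d) (divR R d'))]].
Proof.
move=> _ _; split.
- exact: finite_walls.
- split=> H HW; [exact: wall1_rational|exact: wall2_rational].
(* By contraposition: with no type one wall met properly the type one signs agree at both ends, and
   [relabel] matches the strata. *)
- move=> d d' [_ ad] [_ ad'] var1.
  apply: contrapT => no; case: var1; exists (relabel U Sigma (divR R d) (divR R d')).
  apply/relabel_strata_bij/no_wall1_same_signs => // H HW mp.
  by apply: no; exists H.
- move=> d d' [_ ad] [_ ad'] [_ neq] no1; apply: contrapT => no2; apply: neq.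
  apply: same_signs_equiv; first exact: no_wall1_same_signs.
  apply: no_wall2_same_signs => // H HW mp.
  by apply: no2; exists H.
- split.
  + exact: walls_semichambers_cover.
  + exact: semichamber_disjoint.
  + exact: finite_semichambers.
  + exact: semichamber_scale.
  + by move=> C hC d d' _ _; exact: semichamber_equiv.
Qed.
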